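(* Let $G$ be a connected claw-free graph with maximum degree $\Delta(G) \leq 3$ such that $G$ is not isomorphic to the 3-cycle $C_3$. Then $V(G)$ can be partitioned into four pairwise disjoint cycle isolating sets of $G$.
   Context: All graphs are simple, finite and undirected. A graph is claw-free if it contains no induced subgraph isomorphic to $K_{1,3}$. For $D \subseteq V(G)$, the closed neighborhood $N[D]$ is the set consisting of $D$ together with all vertices having a neighbor in $D$. A subset $D \subseteq V(G)$ is a cycle isolating set of $G$ if $G - N[D]$ contains no cycle (of any length $\geq 3$) as a subgraph. Partitions are weak, i.e. parts may be empty; equivalently, there is a map $c: V(G) \to \{1,2,3,4\}$ (not required to be surjective) such that each of the four color classes is a cycle isolating set of $G$. *)

(* Defs.v *)
From mathcomp Require Import all_boot.

Set Implicit Arguments.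
Unset Strict Implicit.
Unset Printing Implicit Defensive.

Record sgraph := SGraph {
  vertex :> finType;
  adj : rel vertex;
  adj_sym : symmetric adj;
  adj_irr : irreflexive adj
}.

Definition isomorphic (G H : sgraph) : Prop :=
  exists f : G -> H, bijective f /\ forall x y, adj (f x) (f y) = adj x y.

Section Induced.
Variables (G : sgraph) (S : {set G}).

Definition induced_adj : rel {x : G | x \in S} :=
  fun x y => adj (val x) (val y).

Lemma induced_adj_sym : symmetric induced_adj.
Proof. by move=> x y; rewrite /induced_adj adj_sym. Qed.

Lemma induced_adj_irr : irreflexive induced_adj.
Proof. by move=> x; rewrite /induced_adj adj_irr. Qed.

Definition induced : sgraph := SGraph induced_adj_sym induced_adj_irr.
End Induced.

Section CompleteBipartite.
Variables m n : nat.

Definition biclique_adj : rel ('I_m + 'I_n)%type :=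
  fun x y => match x, y with
             | inl _, inr _ | inr _, inl _ => true
             | _, _ => false
             end.

Lemma biclique_adj_sym : symmetric biclique_adj.
Proof. by case=> [x|x] [y|y]. Qed.

Lemma biclique_adj_irr : irreflexive biclique_adj.
Proof. by case. Qed.

Definition biclique : sgraph := SGraph biclique_adj_sym biclique_adj_irr.
End CompleteBipartite.

Section CycleGraph.
Variable n : nat.

(* The conjunct [i != j] only matters for n = 1; this is the usual cycle C_n
   as soon as n >= 3. *)
Definition cycle_graph_adj : rel 'I_n :=
  fun i j => (i != j) && ((i.+1 %% n == j) || (j.+1 %% n == i)).

Lemma cycle_graph_adj_sym : symmetric cycle_graph_adj.
Proof. by move=> i j; rewrite /cycle_graph_adj eq_sym orbC. Qed.

Lemma cycle_graph_adj_irr : irreflexive cycle_graph_adj.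
Proof. by move=> i; rewrite /cycle_graph_adj eqxx. Qed.

Definition cycle_graph : sgraph :=
  SGraph cycle_graph_adj_sym cycle_graph_adj_irr.
End CycleGraph.

Definition connected_graph (G : sgraph) : Prop :=
  forall x y : G, connect (@adj G) x y.

Definition claw_free (G : sgraph) : Prop :=
  ~ exists S : {set G}, isomorphic (induced S) (biclique 1 3).

Definition max_degree (G : sgraph) : nat :=
  \max_(x : G) #|[set y | adj x y]|.

Definition closed_nbhd (G : sgraph) (D : {set G}) : {set G} :=
  D :|: [set x | [exists y in D, adj x y]].

(* [ucycle] also accepts sequences of fewer than three vertices (such as the
   two ends of an edge), which are not cycles of the graph. *)
Definition has_cycle (G : sgraph) : Prop :=
  exists s : seq G, 3 <= size s /\ ucycle (@adj G) s.

Definition cycle_isolating (G : sgraph) (D : {set G}) : Prop :=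
  ~ has_cycle (induced (~: closed_nbhd D)).

(* The parts of a weak partition may be empty, unlike with [finset.partition];
   hence the indexed family. *)
Definition weak_partition (T : finType) (k : nat) (D : 'I_k -> {set T}) : Prop :=
  (forall i j : 'I_k, i != j -> [disjoint D i & D j]) /\
  \bigcup_(i < k) D i = [set: T].

(* Main.v *)
Require Import Defs.
From mathcomp Require Import all_boot.

(** It suffices to find a colouring [c] such that every nonempty vertex set of
    minimum degree at least 2 (a "core"; vertex sets of cycles are cores) sees
    all four colours in its closed neighbourhood.

    Colours are assigned greedily, along an order in which each step continues
    from a vertex treated in the previous step whenever that vertex still has an
    untreated neighbour.  A step enters the untreated set [R] along an edge [pv].
    If [v] lies in a triangle [vxy] of [R], then the neighbours of [v] are
    [p], [x], [y]; [v] gets the colour 0 and [x], [y] the two colours that are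
    neither 0 nor [c p] (by invariant nonzero), so that [v] sees everything.
    A core in [R] which avoids [v] but contains [x] or [y] must leave the
    triangle through both [x] and [y].  So it contains the entry vertex of the
    next step; either that vertex sees everything, or it is treated alone and is
    given the colour [c p], which the core did not see yet.  If [v] is in no triangle of [R], it has
    at most one neighbour in [R] by claw-freeness and is treated alone.

    The process starts from a vertex outside all triangles, from a diamond, or
    from a triangle when the triangles partition the graph.  In the last case a
    core meeting the initial triangle, coloured 1, 2, 3, must still see the
    colour 0, which occurs in every other triangle. *)

Section CycleIsolatingColouring.
Set Implicit Arguments.
Unset Strict Implicit.
Unset Printing Implicit Defensive.

Variable G : sgraph.
Implicit Types (v w x y z a b d : G) (C R : {set G}) (c : G -> 'I_4).

(** * Cores and rainbow colourings *)

Definition core C :=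
  forall x, x \in C ->
    exists a b, [/\ a \in C, b \in C, adj x a, adj x b & a != b].

Definition rainbow c C :=
  forall i, exists x y, [/\ x \in C, (y == x) || adj x y & c y = i].

Definition in_triangle R v :=
  [exists x in R, exists y in R, [&& adj v x, adj v y & adj x y]].

Lemma in_triangleP R v :
  reflect (exists x y, [/\ x \in R, y \in R, adj v x, adj v y & adj x y])
          (in_triangle R v).
Proof.
apply: (iffP exists_inP) => [[x Rx /exists_inP[y Ry /and3P[]]]|].
  by exists x, y.
case=> x [y [Rx Ry vx vy xy]]; exists x => //.
by apply/exists_inP; exists y => //; apply/and3P.
Qed.

Lemma adj_neq x y : adj x y -> x != y.
Proof. by apply: contraTneq => ->; rewrite adj_irr. Qed.

Lemma rainbow_seq c C (s : seq G) :
    (forall y, y \in s -> exists2 x, x \in C & (y == x) || adj x y) ->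
    (forall i, i \in map c s) ->
  rainbow c C.
Proof.
move=> sC cs i; have /mapP[y sy ->] := cs i.
by have [x Cx xy] := sC y sy; exists x, y.
Qed.

Lemma rainbow_at c C v : rainbow c [set v] -> v \in C -> rainbow c C.
Proof. by move=> cv Cv i; have [x [y [/set1P -> vy <-]]] := cv i; exists v, y. Qed.

(** The vertices of a cycle that avoids the closed neighbourhood of colour class [i] form a core, so
    one of them would see colour [i] after all. *)
Lemma isolating_of_rainbow c i :
    (forall C, C != set0 -> core C -> rainbow c C) ->
  cycle_isolating [set x | c x == i].
Proof.
move=> cC [s [s_ge3 /andP[s_cyc s_uniq]]].
have [|x coreC|x [y [Cx xy cy]]] := cC [set val x | x in s] _ _ i.
- case: s s_ge3 {s_cyc s_uniq} => // x s _; apply/set0Pn; exists (val x).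
  by rewrite imset_f ?mem_head.
- have [z sz ->] := imsetP coreC.
  (* Rotating the cycle to start at [z] exposes the two cycle neighbours of [z] as the second and
     the last entry. *)
  have [k t def_s] := rot_to sz.
  have mem_t u : u \in z :: t -> val u \in [set val x | x in s].
    by rewrite -def_s mem_rot => su; rewrite imset_f.
  move: s_cyc s_uniq s_ge3; rewrite -(rot_cycle k) -(rot_uniq k) -(size_rot k s) {}def_s in mem_t *.
  case: t mem_t => [|a t] //=; case/lastP: t => [|t b] //= mem_t.
  rewrite rcons_path last_rcons => /and3P[za _ bz] /and3P[_ a_t _] _.
  exists (val a), (val b).
  have sb : b \in rcons t b by rewrite mem_rcons mem_head.
  rewrite !mem_t ?inE ?eqxx ?sb ?orbT //; split=> //; first by rewrite adj_sym.
  by rewrite (inj_eq val_inj); apply: contraNneq a_t => ->.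
have [z _ def_x] := imsetP Cx; have := valP z; rewrite -def_x !inE.
rewrite negb_or => /andP[cx /exists_inP[]].
case/orP: xy => [/eqP yx|xy]; first by rewrite -yx cy eqxx in cx.
by exists y; rewrite ?inE ?cy.
Qed.

(** * Local forms of claw-freeness, the degree bound and connectedness *)

Lemma claw_free_adj v a b d :
    claw_free G -> adj v a -> adj v b -> adj v d -> uniq [:: a; b; d] ->
  [|| adj a b, adj a d | adj b d].
Proof.
move=> hclaw va vb vd abd; apply/negPn/negP; rewrite !negb_or.
move=> /and3P[/negbTE nab /negbTE nad /negbTE nbd]; case: hclaw.
pose S := v |: [set x in [:: a; b; d]]; exists S.
(* The centre goes to the one-vertex side, a leaf to its position in [[:: a; b; d]]. *)
pose f (x : induced S) : biclique 1 3 :=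
  if val x == v then inl ord0 else inr (inord (index (val x) [:: a; b; d])).
have valS (x : induced S) : val x = v \/ val x \in [:: a; b; d].
  by have := valP x; rewrite !inE => /predU1P[]; [left | right].
have nv x : x \in [:: a; b; d] -> (x == v) = false.
  by rewrite !inE => /or3P[]/eqP->; rewrite eq_sym; apply/negbTE/adj_neq.
have nva x : x \in [:: a; b; d] -> adj v x.
  by rewrite !inE => /or3P[]/eqP->.
have idx_lt x : x \in [:: a; b; d] -> index x [:: a; b; d] < 3.
  by rewrite -index_mem.
have nsym x y : x \in [:: a; b; d] -> y \in [:: a; b; d] -> adj x y = false.
  by rewrite !inE => /or3P[]/eqP-> /or3P[]/eqP->; rewrite ?adj_irr // adj_sym.
exists f; split.
  apply: inj_card_bij => [x y|].
    move=> fxy; apply: val_inj; move: fxy; rewrite /f.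
    have [->|sx] := valS x; have [->|sy] := valS y; rewrite ?eqxx ?nv //.
    case=> /(congr1 (@nat_of_ord 3)); rewrite !inordK ?idx_lt //.
    by move/(congr1 (nth v [:: a; b; d])); rewrite !nth_index.
  rewrite card_sum !card_ord card_sig.
  rewrite (eq_card (B := v |: [set x in [:: a; b; d]])) // cardsU1 cardsE.
  rewrite (card_uniqP abd) inE; case: (boolP (v \in _)) => // /nv; by rewrite eqxx.
move=> x y; rewrite [in RHS]/= /induced_adj /f.
have [->|sx] := valS x; have [->|sy] := valS y; rewrite ?eqxx ?nv //.
- by rewrite (@adj_irr G).
- by rewrite nva.
- by rewrite (@adj_sym G) nva.
- by rewrite nsym.
Qed.

Lemma max_degree_adj x a b d w :
    max_degree G <= 3 -> adj x a -> adj x b -> adj x d -> uniq [:: a; b; d] ->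
  adj x w -> w \in [:: a; b; d].
Proof.
move=> hdeg xa xb xd abd xw; apply/negPn/negP => nw.
have : #|[set y | adj x y]| <= 3.
  by apply: leq_trans hdeg; apply: (leq_bigmax (F := fun x => #|[set y | adj x y]|)).
have /card_uniqP wabd : uniq (w :: [:: a; b; d]) by rewrite cons_uniq nw.
suff /subset_leq_card le4 : [:: w; a; b; d] \subset [set y | adj x y].
  by move/(leq_trans le4); rewrite wabd.
by apply/subsetP=> y; rewrite !inE => /or4P[]/eqP->.
Qed.

Lemma connected_cut R x y :
    connected_graph G -> x \notin R -> y \in R ->
  exists p v, [/\ p \notin R, v \in R & adj p v].
Proof.
move=> hconn nRx Ry; have [/exists_inP[p Rp /exists_inP[v Rv pv]]|] :=
    boolP [exists p in ~: R, exists v in R, adj p v].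
  by exists p, v; rewrite inE in Rp.
move=> cut; have : closed (@adj G) R.
  apply: intro_closed => [|p v pv Rp]; first exact: (sym_connect_sym (@adj_sym G)).
  apply: contraR cut => nRv; apply/exists_inP; exists v; rewrite ?inE //.
  by apply/exists_inP; exists p; rewrite // adj_sym.
by move/closed_connect => /(_ _ _ (hconn x y)); rewrite Ry (negbTE nRx).
Qed.

Lemma two_more_colours (k : 'I_4) : k != ord0 ->
  exists k1 k2, [/\ k1 != ord0, k2 != ord0 & forall i, i \in [:: ord0; k; k1; k2]].
Proof.
have o1 : 1 < 4 by []. have o2 : 2 < 4 by []. have o3 : 3 < 4 by [].
case: k => [[|[|[|[|k]]]] //= ltk] _.
- by exists (Ordinal o2), (Ordinal o3); split=> //; case=> [[|[|[|[|]]]]].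
- by exists (Ordinal o1), (Ordinal o3); split=> //; case=> [[|[|[|[|]]]]].
- by exists (Ordinal o1), (Ordinal o2); split=> //; case=> [[|[|[|[|]]]]].
Qed.

(** * Invariants and the greedy extension *)

Definition diamond_free :=
  forall a b x y, adj a b -> adj a x -> adj b x -> adj a y -> adj b y -> x = y.

(** Makes the entry vertex [p] nonadjacent to the neighbours of [v] in [R], so that two nonadjacent
    such neighbours would complete a claw with [p]. *)
Definition triangle_cut_free R :=
  forall q a b, q \notin R -> a \in R -> b \in R -> adj q a -> adj q b -> ~~ adj a b.

(** Colour 0 is kept for the vertex at which a triangle is entered, so it has to differ from the
    colour of the vertex from which it is entered. *)
Definition boundary_avoids0 c R :=
  forall q a, q \notin R -> a \in R -> adj q a -> c q != ord0.

(** The last clause serves the start from a triangle: its colours 1, 2, 3 leave 0 to be supplied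
    from outside. *)
Definition extends c c' R :=
  [/\ forall x, x \notin R -> c' x = c x,
      forall C, C != set0 -> core C -> C \subset R -> rainbow c' C
    & diamond_free -> forall z, z \in R -> in_triangle R z ->
        exists2 w, (w == z) || adj z w & c' w = ord0].

(** A core vertex with a neighbour outside the core has at most two others, by the degree bound, and
    needs both. *)
Lemma third_neighbour C x a b :
    max_degree G <= 3 -> core C -> x \in C -> a \notin C ->
    adj x a -> adj x b -> a != b ->
  b \in C /\ exists2 d, d \in C & adj x d && (d != b).
Proof.
move=> hdeg coreC Cx nCa xa xb nab; have [d1 [d2 [Cd1 Cd2 xd1 xd2 d12]]] := coreC x Cx.
have nad d : d \in C -> a != d by apply: contraTneq => <-.
have [bd1|nbd1] := eqVneq b d1.
  by subst d1; split=> //; exists d2; rewrite // xd2 eq_sym.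
have := max_degree_adj hdeg xa xb xd1 _ xd2.
rewrite /= !inE negb_or nab nad //= nbd1 !(eq_sym d2) (negbTE (nad d2 _)) //=.
rewrite (negbTE d12) orbF => /(_ isT)/eqP bd2; subst d2.
by split=> //; exists d1; rewrite // xd1 eq_sym.
Qed.

Lemma unique_third_neighbour q a b u w :
    max_degree G <= 3 -> adj q a -> adj q b -> a != b ->
    adj q u -> u \notin [set a; b] -> adj q w -> w \notin [set a; b] -> u = w.
Proof.
move=> hdeg qa qb nab qu; rewrite !inE => /norP[nua nub] qw /norP[nwa nwb].
have := max_degree_adj hdeg qa qb qu _ qw.
rewrite /= !inE negb_or nab !(eq_sym _ u) nua nub (negbTE nwa) (negbTE nwb) /=.
by move/(_ isT)/eqP.
Qed.

(** Induction on a bound for [#|R|]. The colour [j] of an entry vertex in no triangle of [R] is left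
    to the caller, who can thus supply the colour that a core still lacks. *)
Lemma greedy_extension n R c p v j :
    connected_graph G -> claw_free G -> max_degree G <= 3 ->
    #|R| <= n -> triangle_cut_free R -> boundary_avoids0 c R ->
    p \notin R -> v \in R -> adj p v -> j != ord0 ->
  exists2 c', extends c c' R &
    if in_triangle R v then c' v = ord0 /\ rainbow c' [set v] else c' v = j.
Proof.
move=> hconn hclaw hdeg.
elim: n R c p v j => [|n IHn] R c p v j.
  by rewrite leqn0 cards_eq0 => /eqP-> _ _ _; rewrite inE.
move=> leRn cutR bdR nRp Rv pv nj0; case: (boolP (in_triangle R v)) => [/in_triangleP | ntri].
  case=> x [y [Rx Ry vx vy xy]].
  have [[nvx nvy] nxy] := (adj_neq vx, adj_neq vy, adj_neq xy).
  have [npx npy] : p != x /\ p != y by split; apply: contraNneq nRp => ->.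
  have vP w : adj v w -> [|| w == p, w == x | w == y].
    move=> vw; have := max_degree_adj hdeg (_ : adj v p) vx vy _ vw.
    by rewrite !inE /= !inE negb_or npx npy nxy adj_sym pv; apply.
  have [k1 [k2 [nk1 nk2 kP]]] := two_more_colours (bdR _ _ nRp Rv pv).
  pose c1 z := if z == v then ord0 else if z == x then k1 else if z == y then k2 else c z.
  have c1v : c1 v = ord0 by rewrite /c1 eqxx.
  have c1x : c1 x = k1 by rewrite /c1 eq_sym (negbTE nvx) eqxx.
  have c1y : c1 y = k2 by rewrite /c1 !(eq_sym y) (negbTE nvy) (negbTE nxy) eqxx.
  have c1out z : z \notin R -> c1 z = c z.
    by move=> nRz; rewrite /c1 !ifN //; apply: contraNneq nRz => ->.
  pose R' := R :\: [set v; x; y].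
  have R'P z : (z \in R') = [&& z != v, z != x, z != y & z \in R].
    by rewrite !inE !negb_or -!andbA.
  have [nR'v nR'x nR'y] : [/\ v \notin R', x \notin R' & y \notin R'].
    by rewrite !R'P !eqxx !andbF.
  have sR'R : R' \subset R by apply: subsetDl.
  have outP q : q \notin R' -> [\/ q \notin R, q = v, q = x | q = y].
    by rewrite R'P !negb_and !negbK; case/or4P; try (move/eqP=> ->); [constructor 2|constructor 3|constructor 4|constructor 1].
  (* Besides [v] and each other, [x] and [y] have at most one neighbour each. *)
  have exit1 q a b : q \in [set x; y] -> a \in R' -> b \in R' -> adj q a -> adj q b -> a = b.
    move=> qxy R'a R'b qa qb.
    have nK z : z \in R' -> (z \notin [set v; y]) * (z \notin [set v; x]).
      by rewrite R'P !inE => /and4P[/negbTE-> /negbTE-> /negbTE-> _].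
    have [nya nxa] := nK a R'a; have [nyb nxb] := nK b R'b.
    case/set2P: qxy qa qb => -> qa qb.
      by apply: (unique_third_neighbour hdeg (_ : adj x v) xy nvy qa nya qb nyb); rewrite adj_sym.
    by apply: (unique_third_neighbour hdeg (_ : adj y v) (_ : adj y x) nvx qa nxa qb nxb); rewrite adj_sym.
  have nR'p : p \notin R' by apply: contra nRp; apply: subsetP.
  have v_out a : a \in R' -> adj v a = false.
    by move=> R'a; apply: contraTF R'a => /vP/or3P[]/eqP->.
  have cutR' : triangle_cut_free R'.
    move=> q a b /outP[nRq|->|->|->] R'a R'b; first by exact: cutR nRq (subsetP sR'R a R'a) (subsetP sR'R b R'b).
    - by rewrite v_out.
    - by move=> qa qb; rewrite (exit1 x a b) ?adj_irr ?set21.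
    - by move=> qa qb; rewrite (exit1 y a b) ?adj_irr ?set22.
  have bdR' : boundary_avoids0 c1 R'.
    move=> q a /outP[nRq|->|->|->] R'a.
    - by rewrite c1out //; exact: bdR nRq (subsetP sR'R a R'a).
    - by rewrite v_out.
    - by rewrite c1x.
    - by rewrite c1y.
  have leR'n : #|R'| <= n.
    by rewrite -ltnS (leq_trans _ leRn) // proper_card // properE sR'R; apply/subsetPn; exists v.
  (* Continuing through an exit of [x] or [y] whenever there is one ensures
     that a core inside [R] crossing the edge [xy] meets the next step. *)
  have [c' ext exitP] : exists2 c', extends c1 c' R' &
      forall C x' y', x \in C -> x' \in C -> y \in C -> y' \in C ->
      x' \in R' -> y' \in R' -> adj x x' -> adj y y' -> rainbow c' C.
    have [R'0|[z R'z]] := set_0Vmem R'.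
      exists c1; last by move=> C x' y' _ _ _ _; rewrite R'0 inE.
      split=> // [C nC0 _|_ z]; last by rewrite R'0 inE.
      by rewrite R'0 subset0 (negbTE nC0).
    have [/exists_inP[q qxy /exists_inP[w R'w qw]]|noexit] :=
      boolP [exists q in [set x; y], exists w in R', adj q w].
      have nR'q : q \notin R' by case/set2P: qxy => ->.
      (* The prescribed colour [c p] is the one missing among 0, [k1], [k2]. *)
      have [c' ext c'w] := IHn R' c1 q w (c p) leR'n cutR' bdR' nR'q R'w qw (bdR _ _ nRp Rv pv).
      exists c' => // C x' y' Cx Cx' Cy Cy' R'x' R'y' xx' yy'.
      have Cq : q \in C by case/set2P: qxy => ->.
      have Cw : w \in C.
        case/set2P: (qxy) => eq_q.
          by have -> : w = x' by apply: (exit1 q); rewrite // eq_q.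
        by have -> : w = y' by apply: (exit1 q); rewrite // eq_q.
      (* Either [w] alone sees all colours, or [w] has colour [c p] and [q] sees all four on [v],
         [w], [x], [y]. *)
      case: ifP c'w => _ => [[_ satw]|c'w]; first exact: rainbow_at satw Cw.
      have [cR' _ _] := ext.
      apply: (rainbow_seq (s := [:: v; w; x; y])) => [u su|i]; last first.
        by rewrite /= c'w !cR' // c1v c1x c1y.
      exists q => //; move: u su; apply/allP.
      have qv : adj q v by case/set2P: qxy => ->; rewrite adj_sym.
      rewrite /= qv qw !orbT /=; case/set2P: qxy => ->; first by rewrite eqxx xy orbT.
      by rewrite adj_sym xy eqxx orbT.
    (* No edge leads from [x] or [y] into [R'], so [x'] cannot exist; the process continues along
       any edge into [R']. *)
    have [q [w [nR'q R'w qw]]] := connected_cut hconn nR'v R'z.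
    have [c' ext _] := IHn R' c1 q w (c p) leR'n cutR' bdR' nR'q R'w qw (bdR _ _ nRp Rv pv).
    exists c' => // C x' y' _ _ _ _ R'x' _ xx' _; case/exists_inP: noexit.
    by exists x; rewrite ?set21 //; apply/exists_inP; exists x'.
  have [c'out c'core c'tri] := ext.
  have [c'v c'x c'y] : [/\ c' v = ord0, c' x = k1 & c' y = k2] by rewrite !c'out.
  have satv : rainbow c' [set v].
    apply: (rainbow_seq (s := [:: v; p; x; y])) => [u|i]; last first.
      by rewrite /= c'v c'x c'y c'out ?c1out.
    move=> su; exists v; first exact: set11.
    by move: u su; apply/allP; rewrite /= eqxx vx vy (adj_sym v p) pv !orbT.
  exists c' => //; split.
  - move=> z nRz; rewrite c'out ?c1out //; by apply: contra nRz; apply: subsetP.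
  - move=> C nC0 coreC sCR.
    have [Cv|nCv] := boolP (v \in C); first exact: rainbow_at satv Cv.
    have inR' z : z \in C -> z != x -> z != y -> z \in R'.
      move=> Cz nzx nzy; rewrite R'P nzx nzy (subsetP sCR) // !andbT.
      by apply: contraNneq nCv => <-.
    (* A core avoiding [v] contains both or neither of [x], [y]; if both, it also contains an exit
       of each. *)
    have xC : x \in C -> y \in C /\ exists x', [/\ x' \in C, x' \in R' & adj x x'].
      move=> Cx; have [|Cy [x' Cx' /andP[xx' nx'y]]] := third_neighbour hdeg coreC Cx nCv _ xy nvy.
        by rewrite adj_sym.
      by split=> //; exists x'; rewrite Cx' xx' inR' // eq_sym adj_neq.
    have yC : y \in C -> x \in C /\ exists y', [/\ y' \in C, y' \in R' & adj y y'].
      move=> Cy; have [||Cx [y' Cy' /andP[yy' ny'x]]] := third_neighbour hdeg coreC Cy nCv (_ : adj y v) (_ : adj y x) nvx.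
      + by rewrite adj_sym.
      + by rewrite adj_sym.
      by split=> //; exists y'; rewrite Cy' yy' inR' // eq_sym adj_neq.
    have [Cx|nCx] := boolP (x \in C).
      have [Cy [x' [Cx' R'x' xx']]] := xC Cx; have [_ [y' [Cy' R'y' yy']]] := yC Cy.
      exact: (exitP C x' y').
    have nCy : y \notin C by apply: contra nCx => /yC[].
    apply: c'core => //; apply/subsetP=> z Cz; apply: inR' => //.
      by apply: contraNneq nCx => <-.
    by apply: contraNneq nCy => <-.
  - move=> dfree z Rz /in_triangleP[a [b [Ra Rb za zb ab]]].
    have [->|nzv] := eqVneq z v; first by exists v; rewrite ?eqxx.
    have [->|nzx] := eqVneq z x; first by exists v; rewrite ?c'v // adj_sym vx orbT.
    have [->|nzy] := eqVneq z y; first by exists v; rewrite ?c'v // adj_sym vy orbT.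
    have R'z : z \in R' by rewrite R'P nzv nzx nzy.
    (* The triangle at [z] stays inside [R']: with just one of [x], [y] it would give that vertex
       two exits, and with both it would form a diamond with [v]. *)
    have nz t u : adj z t -> adj z u -> adj t u -> t \in R -> u \in R -> t \in R'.
      move=> zt zu tu Rt Ru; rewrite R'P Rt andbT.
      have ntv : t != v.
        by apply: contraTneq zt => ->; rewrite adj_sym v_out.
      have nuv : u != v.
        by apply: contraTneq zu => ->; rewrite adj_sym v_out.
      rewrite ntv /=; apply/andP; split; apply/eqP => eq_t; subst t.
        have [eq_u|nuy] := eqVneq u y.
          by subst u; case/eqP: nzv; apply: (dfree x y); rewrite // adj_sym.
        have R'u : u \in R' by rewrite R'P nuv nuy Ru eq_sym (adj_neq tu).
        by rewrite (exit1 x z u) ?adj_irr ?set21 // 1?adj_sym in zu.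
      have [eq_u|nux] := eqVneq u x.
        by subst u; case/eqP: nzv; apply: (dfree x y); rewrite // adj_sym.
      have R'u : u \in R' by rewrite R'P nuv nux Ru eq_sym (adj_neq tu).
      by rewrite (exit1 y z u) ?adj_irr ?set22 // 1?adj_sym in zu.
    apply: c'tri => //; apply/in_triangleP; exists a, b; split=> //.
      exact: (nz a b).
    by apply: (nz b a) => //; rewrite adj_sym.
pose c1 z := if z == v then j else c z.
have c1v : c1 v = j by rewrite /c1 eqxx.
have c1out z : z \notin R -> c1 z = c z.
  by move=> nRz; rewrite /c1 ifN //; apply: contraNneq nRz => ->.
have sR'R : R :\ v \subset R by apply: subsetDl.
have nR'v : v \notin R :\ v by rewrite !inE eqxx.
have outP q : q \notin R :\ v -> q \notin R \/ q = v.
  by rewrite !inE negb_and negbK => /orP[/eqP|]; [right|left].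
(* Two neighbours of [v] in [R] would form a claw with [p], or a triangle of [R] with [v]. *)
have exit1 a b : a \in R -> b \in R -> adj v a -> adj v b -> a = b.
  move=> Ra Rb va vb; apply/eqP/negPn/negP => nab.
  have np z : z \in R -> p != z by move=> Rz; apply: contraNneq nRp => ->.
  have [||pa|pb|ab] := or3P (claw_free_adj hclaw (_ : adj v p) va vb _).
  - by rewrite adj_sym.
  - by rewrite /= !inE negb_or !np // nab.
  - by have := cutR p v a nRp Rv Ra pv pa; rewrite va.
  - by have := cutR p v b nRp Rv Rb pv pb; rewrite vb.
  - by case/in_triangleP: ntri; exists a, b.
have cutR' : triangle_cut_free (R :\ v).
  move=> q a b /outP[nRq|->] R'a R'b; first by exact: cutR nRq (subsetP sR'R a R'a) (subsetP sR'R b R'b).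
  by move=> qa qb; rewrite (exit1 a b) ?adj_irr // (subsetP sR'R).
have bdR' : boundary_avoids0 c1 (R :\ v).
  move=> q a /outP[nRq|->] R'a; last by rewrite c1v.
  by rewrite c1out //; exact: bdR nRq (subsetP sR'R a R'a).
have leR'n : #|R :\ v| <= n by rewrite (cardsD1 v) Rv in leRn.
have [c' [c'out c'core c'tri]] : exists c', extends c1 c' (R :\ v).
  have [R'0|[z R'z]] := set_0Vmem (R :\ v).
    exists c1; split=> // [C nC0 _|_ z]; last by rewrite R'0 inE.
    by rewrite R'0 subset0 (negbTE nC0).
  have [q [w [nR'q R'w qw]]] := connected_cut hconn nR'v R'z.
  by have [c' ext _] := IHn _ c1 q w j leR'n cutR' bdR' nR'q R'w qw nj0; exists c'.
exists c'; last by rewrite c'out.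
split.
- by move=> z nRz; rewrite c'out ?c1out //; apply: contra nRz; apply: subsetP.
(* Having at most one neighbour in [R], [v] lies in no core inside [R]. *)
- move=> C nC0 coreC sCR; apply: c'core => //.
  apply/subsetP=> z Cz; rewrite !inE (subsetP sCR) // andbT.
  apply: contraTneq Cz => ->; apply/negP=> Cv.
  have [a [b [Ca Cb va vb /eqP[]]]] := coreC v Cv.
  by apply: exit1; rewrite ?(subsetP sCR).
- move=> dfree z Rz tri_z.
  have nzv : z != v by apply: contraNneq ntri => <-.
  case/in_triangleP: tri_z => a [b [Ra Rb za zb ab]].
  have nv t u : adj z t -> adj z u -> adj t u -> u \in R -> t != v.
    move=> zt zu tu Ru; apply: contraNneq ntri => <-; apply/in_triangleP.
    by exists z, u; split=> //; rewrite adj_sym.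
  apply: c'tri => //; first by rewrite !inE nzv.
  apply/in_triangleP; exists a, b; rewrite !inE Ra Rb (nv a b) ?(nv b a) //.
  by rewrite adj_sym.
Qed.

Lemma extension_exists R c r :
    connected_graph G -> claw_free G -> max_degree G <= 3 ->
    triangle_cut_free R -> boundary_avoids0 c R -> r \notin R ->
  exists c', extends c c' R.
Proof.
move=> hconn hclaw hdeg cutR bdR nRr; have [R0|[z Rz]] := set_0Vmem R.
  exists c; split=> // [C nC0 _|_ z]; last by rewrite R0 inE.
  by rewrite R0 subset0 (negbTE nC0).
have [p [v [nRp Rv pv]]] := connected_cut hconn nRr Rz.
have [//|c' ext _] := greedy_extension hconn hclaw hdeg (leqnn #|R|) cutR bdR nRp Rv pv (j := ord_max).
by exists c'.
Qed.

(** * The possible starting configurations *)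

(** A core vertex with a neighbour outside the core would be the centre of a claw. So by
    connectedness every core is the whole graph, and each colour only has to occur. *)
Lemma colouring_triangle_free :
    connected_graph G -> claw_free G -> (forall v, ~~ in_triangle [set: G] v) ->
  exists c, forall C, C != set0 -> core C -> rainbow c C.
Proof.
move=> hconn hclaw ntri.
have nadj v a b : adj v a -> adj v b -> ~~ adj a b.
  by move=> va vb; apply: contra (ntri v) => ab; apply/in_triangleP; exists a, b.
(* The first four vertices of the enumeration get distinct colours; [inord] sends all later ones to
   0. *)
exists (fun x => inord (enum_rank x)) => C /set0Pn[v Cv] coreC.
have [a [b [Ca Cb va vb nab]]] := coreC v Cv.
(* This [d] is a fourth vertex, since [d = b] would close a triangle. *)
have [d ad ndv] : exists2 d, adj a d & d != v.
  have [d1 [d2 [_ _ ad1 ad2 nd]]] := coreC a Ca.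
  by have [eq_v|] := eqVneq d1 v; [exists d2; rewrite // -eq_v eq_sym | exists d1].
have le4G : 4 <= #|G|.
  suff us : uniq [:: v; a; b; d] by rewrite -[4]/(size [:: v; a; b; d]) -(card_uniqP us) max_card.
  rewrite /= !inE !negb_or (adj_neq va) (adj_neq vb) (eq_sym v) ndv nab (adj_neq ad) /= ?andbT.
  by apply: contraTneq ad => <-; apply: nadj va vb.
have CT x : x \in C.
  apply/negPn/negP => nCx; have [p [q [nCp Cq pq]]] := connected_cut hconn nCx Cv.
  have [a' [b' [Ca' Cb' qa' qb' nab']]] := coreC q Cq.
  have np z : z \in C -> p != z by move=> Cz; apply: contraNneq nCp => ->.
  have qp : adj q p by rewrite adj_sym.
  have := claw_free_adj hclaw qp qa' qb'.
  rewrite /= !inE negb_or !np // nab' => /(_ isT).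
  by case/or3P; apply/negP; apply: (nadj q).
move=> i; have ltiG := leq_trans (ltn_ord i) le4G.
exists (enum_val (Ordinal ltiG)), (enum_val (Ordinal ltiG)).
by rewrite CT eqxx enum_valK inord_val.
Qed.

(** Some edge [rs] joins a vertex in no triangle to a vertex in one. Entering along it makes [s] see
    all colours, and by claw-freeness at [r] every core through [r] contains [s]. *)
Lemma colouring_mixed r t :
    connected_graph G -> claw_free G -> max_degree G <= 3 ->
    ~~ in_triangle [set: G] r -> in_triangle [set: G] t ->
  exists c, forall C, C != set0 -> core C -> rainbow c C.
Proof.
move=> hconn hclaw hdeg ntri_r tri_t.
have [{ntri_r}r [s [ntri_r tri_s rs]]] :
    exists r s, [/\ r \notin [set v | in_triangle [set: G] v],
                    s \in [set v | in_triangle [set: G] v] & adj r s].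
  by apply: (connected_cut hconn (x := r) (y := t)); rewrite inE.
rewrite !inE in ntri_r tri_s.
have nadj a b : adj r a -> adj r b -> ~~ adj a b.
  by move=> ra rb; apply: contra ntri_r => ab; apply/in_triangleP; exists a, b.
have cutR : triangle_cut_free [set~ r].
  by move=> q a b; rewrite !inE negbK => /eqP-> _ _; apply: nadj.
have bdR : boundary_avoids0 (fun=> ord_max) [set~ r] by [].
have nRr : r \notin [set~ r] by rewrite !inE eqxx.
have Rs : s \in [set~ r] by rewrite !inE eq_sym adj_neq.
have [//|c [_ cR _]] :=
  greedy_extension hconn hclaw hdeg (leqnn _) cutR bdR nRr Rs rs (j := ord_max).
rewrite ifT => [[_ sat_s]|]; last first.
  have [x [y [_ _ sx sy xy]]] := in_triangleP _ _ tri_s.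
  have nr a b : adj s a -> adj s b -> adj a b -> a \in [set~ r].
    move=> sa sb ab; rewrite !inE; apply: contraTneq sb => eq_a.
    by apply: nadj; rewrite // -eq_a.
  by apply/in_triangleP; exists x, y; rewrite (nr x y) // (nr y x) // adj_sym.
exists c => C nC0 coreC; have [Cr|nCr] := boolP (r \in C); last first.
  by apply: cR => //; apply/subsetP=> z Cz; rewrite !inE; apply: contraNneq nCr => <-.
apply: (rainbow_at sat_s); apply/negPn/negP=> nCs.
have [a [b [Ca Cb ra rb nab]]] := coreC r Cr.
have ns z : z \in C -> s != z by move=> Cz; apply: contraNneq nCs => ->.
have := claw_free_adj hclaw rs ra rb.
rewrite /= !inE negb_or !ns // nab => /(_ isT).
by case/or3P; apply/negP; apply: nadj.
Qed.

(** All neighbours of [a] and [b] lie in the diamond, so both see its four colours. A core avoiding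
    them leaves [x] and [y] with too few neighbours, hence lies in [R]. *)
Lemma colouring_diamond a b x y :
    connected_graph G -> claw_free G -> max_degree G <= 3 ->
    adj a b -> adj a x -> adj b x -> adj a y -> adj b y -> x != y ->
  exists c, forall C, C != set0 -> core C -> rainbow c C.
Proof.
move=> hconn hclaw hdeg ab ax bx ay by_ nxy.
pose R := ~: [set a; b; x; y].
have [xa xb ya yb ba] : [/\ adj x a, adj x b, adj y a, adj y b & adj b a].
  by split; rewrite adj_sym.
have nab := adj_neq ab.
(* Colour 0 goes to [a], which has no neighbour in [R]; [x] and [y], which may have one, get nonzero
   colours. *)
pose c z : 'I_4 := if z == b then Ordinal (isT : 1 < 4) else
  if z == x then Ordinal (isT : 2 < 4) else if z == y then ord_max else ord0.
have ca : c a = ord0 by rewrite /c !ifN // adj_neq.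
have cb : c b = Ordinal (isT : 1 < 4) by rewrite /c eqxx.
have cx : c x = Ordinal (isT : 2 < 4) by rewrite /c ifN ?adj_neq // eqxx.
have cy : c y = ord_max by rewrite /c ifN ?adj_neq // ifN ?eqxx // eq_sym.
have RP z : z \in R -> [/\ z != a, z != b, z != x & z != y].
  by rewrite !inE !negb_or -!andbA => /and4P[].
have outP q : q \notin R -> [\/ q = a, q = b, q = x | q = y].
  by rewrite !inE negbK -!orbA => /or4P[]/eqP->; [constructor 1|constructor 2|constructor 3|constructor 4].
have abR z : z \in R -> (adj a z = false) * (adj b z = false).
  move=> /RP[/negbTE nza /negbTE nzb /negbTE nzx /negbTE nzy].
  split; apply/negbTE/negP => wz.
    have := max_degree_adj hdeg ab ax ay _ wz.
    by rewrite !inE nzb nzx nzy /= !inE negb_or (adj_neq bx) (adj_neq by_) nxy => /(_ isT).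
  have := max_degree_adj hdeg ba bx by_ _ wz.
  by rewrite !inE nza nzx nzy /= !inE negb_or (adj_neq ax) (adj_neq ay) nxy => /(_ isT).
have nRab z : z \in R -> z \notin [set a; b].
  by move=> /RP[nza nzb _ _]; rewrite !inE (negbTE nza).
have cutR : triangle_cut_free R.
  move=> q z w /outP[]-> Rz Rw; rewrite ?abR // => qz qw.
    by rewrite (unique_third_neighbour hdeg xa xb nab qz _ qw) ?adj_irr ?nRab.
  by rewrite (unique_third_neighbour hdeg ya yb nab qz _ qw) ?adj_irr ?nRab.
have bdR : boundary_avoids0 c R.
  by move=> q z /outP[]-> Rz; rewrite ?abR // ?cx ?cy.
have [nRa nRb nRx nRy] : [/\ a \notin R, b \notin R, x \notin R & y \notin R].
  by rewrite !inE !eqxx !orbT.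
have [c' [c'out c'R _]] := extension_exists hconn hclaw hdeg cutR bdR nRa.
have c'K : map c' [:: a; b; x; y] =
    [:: ord0; Ordinal (isT : 1 < 4); Ordinal (isT : 2 < 4); ord_max].
  by rewrite /= !c'out // ca cb cx cy.
have c'all i : i \in map c' [:: a; b; x; y].
  by rewrite c'K; case: i => [[|[|[|[|]]]]].
have sata : rainbow c' [set a].
  apply: rainbow_seq c'all => z sz; exists a; first exact: set11.
  by move: z sz; apply/allP; rewrite /= eqxx ab ax ay !orbT.
have satb : rainbow c' [set b].
  apply: rainbow_seq c'all => z sz; exists b; first exact: set11.
  by move: z sz; apply/allP; rewrite /= eqxx ba bx by_ !orbT.
exists c' => C nC0 coreC.
have [Ca|nCa] := boolP (a \in C); first exact: rainbow_at sata Ca.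
have [Cb|nCb] := boolP (b \in C); first exact: rainbow_at satb Cb.
apply: c'R => //; apply/subsetP=> z Cz; rewrite !inE !negb_or -!andbA.
apply/and4P; split; apply: contraTneq Cz => ->; rewrite ?nCa ?nCb //; apply/negP=> Cz.
  by have [Cb] := third_neighbour hdeg coreC Cz nCa xa xb nab; rewrite Cb in nCb.
by have [Cb] := third_neighbour hdeg coreC Cz nCa ya yb nab; rewrite Cb in nCb.
Qed.

Lemma triangle_isomorphic a b d :
    adj a b -> adj a d -> adj b d -> (forall z, z \in [:: a; b; d]) ->
  isomorphic G (cycle_graph 3).
Proof.
move=> ab ad bd sG; pose s := [:: a; b; d].
have us : uniq s by rewrite /= !inE negb_or !adj_neq.
have lts z : index z s < 3 by rewrite -[3]/(size s) index_mem.
exists (fun z => Ordinal (lts z)); split.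
  apply: inj_card_bij => [z w [/(congr1 (nth a s))]|]; first by rewrite !nth_index.
  rewrite card_ord -[3]/(size s) -(card_uniqP us).
  by apply: max_card.
have [nba nda ndb] : [/\ b != a, d != a & d != b] by split; rewrite eq_sym adj_neq.
have [ba da db] : [/\ adj b a, adj d a & adj d b] by split; rewrite adj_sym.
have [ia ib id] : [/\ index a s = 0, index b s = 1 & index d s = 2].
  by rewrite /= !eqxx (eq_sym a) (negbTE nba) (eq_sym a) (negbTE nda) (eq_sym b) (negbTE ndb).
have cycleE z w :
    adj (Ordinal (lts z) : cycle_graph 3) (Ordinal (lts w)) =
    let i := index z s in let k := index w s in
    (i != k) && ((i.+1 %% 3 == k) || (k.+1 %% 3 == i)) by [].
move=> z w; rewrite cycleE; have := sG z; have := sG w; rewrite !inE.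
do 2![case/or3P=> /eqP->]; rewrite ?ia ?ib ?id ?adj_irr //.
all: by rewrite ?ab ?ad ?bd ?ba ?da ?db.
Qed.

Lemma colouring_triangles (t : G) :
    connected_graph G -> claw_free G -> max_degree G <= 3 ->
    ~ isomorphic G (cycle_graph 3) -> diamond_free ->
    (forall v, in_triangle [set: G] v) ->
  exists c, forall C, C != set0 -> core C -> rainbow c C.
Proof.
move=> hconn hclaw hdeg hC3 dfree tri.
have [a [b [d [a' [ab ad bd aa' [na'b na'd]]]]]] : exists a b d a',
    [/\ adj a b, adj a d, adj b d, adj a a' & a' != b /\ a' != d].
  have [x [y [_ _ tx ty xy]]] := in_triangleP _ _ (tri t).
  (* As the graph is not a 3-cycle, some edge leaves the triangle; its inner end is named [a]. *)
  have [z nz|all_z] := pickP [pred z | z \notin [:: t; x; y]]; last first.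
    case: hC3; apply: (triangle_isomorphic tx ty xy) => z.
    by have /negbFE := all_z z.
  have [] := connected_cut hconn (R := ~: [set t; x; y]) (x := t) (y := z).
  - by rewrite !inE eqxx.
  - by move: nz; rewrite !inE !orbA.
  move=> p [v []]; rewrite !inE negbK !negb_or -!orbA -!andbA.
  have [xt yt yx] : [/\ adj x t, adj y t & adj y x].
    by split; rewrite adj_sym.
  case/or3P=> /eqP-> /and3P[nvt nvx nvy] pv.
  - by exists t, x, y, v.
  - by exists x, t, y, v.
  - by exists y, t, x, v.
pose R := ~: [set a; b; d].
have [ba da db] : [/\ adj b a, adj d a & adj d b].
  by split; rewrite adj_sym.
have [[nab nad] nbd] := (adj_neq ab, adj_neq ad, adj_neq bd).
have RP z : z \in R -> [/\ z != a, z != b & z != d].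
  by rewrite !inE !negb_or -!andbA => /and3P[].
have outP q : q \notin R -> [\/ q = a, q = b | q = d].
  by rewrite !inE negbK -!orbA => /or3P[]/eqP->; [constructor 1|constructor 2|constructor 3].
have exit1 q z w : q \notin R -> z \in R -> w \in R -> adj q z -> adj q w -> z = w.
  move=> /outP qK /RP[nza nzb nzd] /RP[nwa nwb nwd]; case: qK => -> qz qw.
  - apply: (unique_third_neighbour hdeg ab ad nbd qz _ qw); rewrite !inE negb_or.
      by rewrite nzb.
    by rewrite nwb.
  - apply: (unique_third_neighbour hdeg ba bd nad qz _ qw); rewrite !inE negb_or.
      by rewrite nza.
    by rewrite nwa.
  - apply: (unique_third_neighbour hdeg da db nab qz _ qw); rewrite !inE negb_or.
      by rewrite nza.
    by rewrite nwa.
(* A triangle at [z] meeting [a], [b], [d] would give one of them two outer neighbours or create a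
   diamond. *)
have triR z : z \in R -> in_triangle R z.
  move=> Rz; have [nza nzb nzd] := RP z Rz.
  have [x [y [_ _ zx zy xy]]] := in_triangleP _ _ (tri z).
  have inR u w : adj z u -> adj z w -> adj u w -> u \in R.
    move=> zu zw uw; apply/negPn/negP=> nRu.
    have uz : adj u z by rewrite adj_sym.
    have [Rw|/outP wK] := boolP (w \in R).
      by rewrite (exit1 u z w) ?adj_irr in zw.
    have nz k : k \notin R -> k <> z by move=> nRk eq_k; rewrite eq_k Rz in nRk.
    have wz : adj w z by rewrite adj_sym.
    have [nRa nRb nRd] : [/\ a \notin R, b \notin R & d \notin R].
      by rewrite !inE !eqxx !orbT.
    case: (outP u nRu) uz uw => -> uz; case: wK wz => -> wz; rewrite ?adj_irr // => _.
    - exact: nz d nRd (dfree a b _ _ ab ad bd uz wz).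
    - exact: nz b nRb (dfree a d _ _ ad ab db uz wz).
    - exact: nz d nRd (dfree b a _ _ ba bd ad uz wz).
    - exact: nz a nRa (dfree b d _ _ bd ba da uz wz).
    - exact: nz b nRb (dfree d a _ _ da db ab uz wz).
    - exact: nz a nRa (dfree d b _ _ db da ba uz wz).
  by apply/in_triangleP; exists x, y; rewrite (inR x y) // (inR y x) // adj_sym.
pose c z : 'I_4 := if z == a then Ordinal (isT : 1 < 4) else
  if z == b then Ordinal (isT : 2 < 4) else ord_max.
have cutR : triangle_cut_free R.
  by move=> q z w nRq Rz Rw qz qw; rewrite (exit1 q z w) ?adj_irr.
have bdR : boundary_avoids0 c R.
  by move=> q z _ _ _; rewrite /c; case: ifP => // _; case: ifP.
have [nRa nRb nRd] : [/\ a \notin R, b \notin R & d \notin R].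
  by rewrite !inE !eqxx !orbT.
have Ra' : a' \in R by rewrite !inE !negb_or na'b na'd eq_sym adj_neq.
have [//|c' [c'out c'R c'tri]] :=
  greedy_extension hconn hclaw hdeg (leqnn _) cutR bdR nRa Ra' aa' (j := ord_max).
rewrite triR // => -[c'a' _].
have [c'a c'b c'd] : [/\ c' a = Ordinal (isT : 1 < 4), c' b = Ordinal (isT : 2 < 4) & c' d = ord_max].
  rewrite !c'out // /c !eqxx (eq_sym b a) (eq_sym d a) (eq_sym d b).
  by rewrite (negbTE nab) (negbTE nad) (negbTE nbd).
exists c' => C nC0 coreC.
(* Any vertex of the initial triangle sees 1, 2, 3, so a core through it only needs a vertex [w]
   that sees 0. *)
have colours z w : z \in [:: a; b; d] -> z \in C -> w \in C ->
    (exists2 u, (u == w) || adj w u & c' u = ord0) -> rainbow c' C.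
  move=> zK Cz Cw [u wu c'u]; apply: (rainbow_seq (s := [:: u; a; b; d])).
    move=> v; rewrite inE => /predU1P[->|vK]; first by exists w.
    exists z => //; move: zK vK; rewrite !inE.
    by do 2![case/or3P=> /eqP->]; rewrite ?eqxx ?ab ?ad ?bd ?ba ?da ?db ?orbT.
  by rewrite /= c'u c'a c'b c'd; case=> [[|[|[|[|]]]]].
have [Ca|nCa] := boolP (a \in C).
  by apply: (colours a a) => //; [rewrite mem_head | exists a'; rewrite ?aa' ?orbT].
(* Without [a], the core contains the outer neighbour [b'] of [b], which lies in a triangle of [R]
   and so sees 0. *)
have bC : b \in C -> rainbow c' C.
  move=> Cb; have [_ [b' Cb' /andP[bb' nb'd]]] := third_neighbour hdeg coreC Cb nCa ba bd nad.
  have Rb' : b' \in R.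
    rewrite !inE !negb_or nb'd andbT (eq_sym b' b) (adj_neq bb') andbT.
    by apply: contraNneq nCa => <-.
  apply: (colours b b') => //; first by rewrite !inE eqxx orbT.
  exact: c'tri (triR b' Rb').
have [Cd|nCd] := boolP (d \in C).
  by have [Cb _] := third_neighbour hdeg coreC Cd nCa da db nab; apply: bC.
have [/bC//|nCb] := boolP (b \in C).
apply: c'R => //; apply/subsetP=> z Cz; rewrite !inE !negb_or -andbA.
by apply/and3P; split; apply: contraTneq Cz => ->.
Qed.

End CycleIsolatingColouring.

(** * Colour classes as the parts, with a case split on triangles and diamonds *)

Theorem theorem1p11 (G : sgraph) (hconn : connected_graph G)
  (hclaw : claw_free G) (hdeg : max_degree G <= 3)
  (hC3 : ~ isomorphic G (cycle_graph 3)) :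
  exists D : 'I_4 -> {set G},
    weak_partition D /\ forall i : 'I_4, cycle_isolating (D i).
Proof.
suff [c cC] : exists c : G -> 'I_4, forall C, C != set0 -> core C -> rainbow c C.
  exists (fun i => [set x | c x == i]); split; last first.
    by move=> i; apply: isolating_of_rainbow.
  split=> [i j nij|].
    by apply/pred0P=> x /=; rewrite !inE; case: eqP => // ->; apply/negbTE.
  by apply/setP=> x; rewrite inE; apply/bigcupP; exists (c x); rewrite ?inE.
have [t tri_t|ntri] := pickP (in_triangle [set: G]); last first.
  by apply: colouring_triangle_free => // v; rewrite ntri.
have [r ntri_r|tri] := pickP (predC (in_triangle [set: G])).
  exact: (colouring_mixed hconn hclaw hdeg ntri_r tri_t).
pose diamond := [exists a : G, exists b, exists x, exists y : G,
  [&& adj a b, adj a x, adj b x, adj a y, adj b y & x != y]].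
have [/existsP[a /existsP[b /existsP[x /existsP[y]]]]|ndia] := boolP diamond.
  case/and5P=> ab ax bx ay /andP[by_ nxy].
  exact: (colouring_diamond hconn hclaw hdeg ab ax bx ay by_ nxy).
apply: (colouring_triangles t) => // [a b x y ab ax bx ay by_|v]; last by have /negbFE := tri v.
apply/eqP/negPn/negP => nxy; case/existsP: ndia; exists a.
apply/existsP; exists b; apply/existsP; exists x; apply/existsP; exists y.
by rewrite ab ax bx ay by_ nxy.
Qed.
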